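(* Let $n \in \mathbb{N}$ and let $w = w(x_1,\ldots,x_n)$ be an element of the free group $F = \langle x_1, \ldots, x_n \rangle$ on $n$ generators. Then the following assertions are equivalent: (1) $w$ is a commutator word, i.e. $w \in [F,F]$; (2) for every natural number $m$ there are only finitely many (isomorphism classes of) finite groups $G$ with $\mathrm{br}_w(G) \leq m$.
   Context: $\mathbb{N}$ denotes the positive integers. For a word $w = w(x_1,\ldots,x_n)$ (an element of the free group $F$ on $x_1,\ldots,x_n$) and a group $G$, the verbal subgroup $w(G)$ is the subgroup of $G$ generated by all values $w(g_1,\ldots,g_n)^{\pm 1}$ with $g_1,\ldots,g_n \in G$. The $w$-breadth of a group $G$ is $\mathrm{br}_w(G) := \sup\{ |H : w(H)| \mid H \leq G\}$. *)

(* Defs.v *)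
From Stdlib Require List.
From HB Require Import structures.
From mathcomp Require Import all_boot all_fingroup.

Set Implicit Arguments.
Unset Strict Implicit.
Unset Printing Implicit Defensive.

Import GroupScope.

(** The free group of rank [n], as the group of reduced words. The letter
    [(i, true)] stands for the generator x_i and [(i, false)] for its inverse. *)

Section FreeGroup.

Variable n : nat.

Definition letter := ('I_n * bool)%type.

Definition letter_inv (a : letter) : letter := (a.1, ~~ a.2).

Lemma letter_invK : involutive letter_inv.
Proof. by case=> i b; rewrite /letter_inv /= negbK. Qed.

Definition reduced (s : seq letter) : bool :=
  sorted (fun a b => b != letter_inv a) s.

Record free_group := FreeWord {
  fword :> seq letter;
  fwordP : reduced fword
}.

HB.instance Definition _ := [isSub for fword].
HB.instance Definition _ := [Countable of free_group by <:].

Definition push (a : letter) (s : seq letter) : seq letter :=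
  if s is b :: s' then if b == letter_inv a then s' else a :: s else [:: a].

Definition cat_reduce (s t : seq letter) : seq letter := foldr push t s.

Definition word_inv (s : seq letter) : seq letter := rev (map letter_inv s).

Lemma reduced_behead a s : reduced (a :: s) -> reduced s.
Proof. exact: path_sorted. Qed.

Lemma push_reduced a s : reduced s -> reduced (push a s).
Proof.
case: s => [|b s] //= Hs; case: eqP => [_|/eqP ne]; first exact: path_sorted Hs.
by rewrite /reduced /= ne.
Qed.

Lemma push_cons a s : reduced (a :: s) -> push a s = a :: s.
Proof. by case: s => [|b s] //= /andP[/negbTE->]. Qed.

Lemma pushK a s : reduced s -> push a (push (letter_inv a) s) = s.
Proof.
case: s => [|b s] /= red_s; first by rewrite eqxx.
rewrite letter_invK; have [eq_ba|_] := eqVneq b a.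
  by rewrite -eq_ba; apply: push_cons.
by rewrite /= eqxx.
Qed.

Lemma cat_reduce_reduced s t : reduced t -> reduced (cat_reduce s t).
Proof. by move=> red_t; elim: s => //= a s; apply: push_reduced. Qed.

Lemma cat_reduce_push a s t :
  reduced t -> cat_reduce (push a s) t = push a (cat_reduce s t).
Proof.
move=> red_t; case: s => [|b s] //=.
by case: eqP => [->|_] //; rewrite pushK //; apply: cat_reduce_reduced.
Qed.

Lemma cat_reduceA s t u : reduced u ->
  cat_reduce s (cat_reduce t u) = cat_reduce (cat_reduce s t) u.
Proof. by move=> red_u; elim: s => //= a s ->; rewrite cat_reduce_push. Qed.

Lemma cat_reduce_nil s : reduced s -> cat_reduce s [::] = s.
Proof.
elim: s => //= a s IHs red_as.
by rewrite IHs ?push_cons //; apply: reduced_behead red_as.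
Qed.

Lemma word_invK : involutive word_inv.
Proof.
by move=> s; rewrite /word_inv map_rev revK -map_comp (eq_map letter_invK) map_id.
Qed.

Lemma word_inv_reduced s : reduced s -> reduced (word_inv s).
Proof.
rewrite /reduced /word_inv rev_sorted sorted_map.
apply: sub_sorted => a b /=; rewrite letter_invK eq_sym; apply: contra => /eqP->.
exact: eqxx.
Qed.

Lemma cat_reduceVs s : reduced s -> cat_reduce (word_inv s) s = [::].
Proof.
elim: s => //= a s IHs red_as.
rewrite /word_inv /= rev_cons /cat_reduce foldr_rcons /= letter_invK eqxx.
by apply: IHs; apply: reduced_behead red_as.
Qed.

Definition fg_one : free_group := FreeWord (isT : reduced [::]).

Definition fg_mul (u v : free_group) : free_group :=
  FreeWord (cat_reduce_reduced u (fwordP v)).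

Definition fg_inv (u : free_group) : free_group :=
  FreeWord (word_inv_reduced (fwordP u)).

Lemma fg_mulA : associative fg_mul.
Proof. by move=> u v w; apply/val_inj/cat_reduceA/fwordP. Qed.

Lemma fg_mul1 : left_id fg_one fg_mul.
Proof. by move=> u; apply: val_inj. Qed.

Lemma fg_mulr1 : right_id fg_one fg_mul.
Proof. by move=> u; apply/val_inj/cat_reduce_nil/fwordP. Qed.

Lemma fg_mulV : left_inverse fg_one fg_inv fg_mul.
Proof. by move=> u; apply/val_inj/cat_reduceVs/fwordP. Qed.

Lemma fg_mulrV : right_inverse fg_one fg_inv fg_mul.
Proof.
move=> u; apply: val_inj => /=.
by rewrite -{1}[fword u]word_invK cat_reduceVs // word_inv_reduced // fwordP.
Qed.

HB.instance Definition _ :=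
  isGroup.Build free_group fg_mulA fg_mul1 fg_mulr1 fg_mulV fg_mulrV.

Definition fg_gen (i : 'I_n) : free_group :=
  FreeWord (isT : reduced [:: (i, true)]).

(** The value w(g_1, ..., g_n). *)
Definition word_eval (G : groupType) (g : 'I_n -> G) (w : free_group) : G :=
  \prod_(a <- fword w) (if a.2 then g a.1 else (g a.1)^-1).

Section WordEval.

Variables (G : groupType) (g : 'I_n -> G).

Lemma word_eval_gen i : word_eval g (fg_gen i) = g i.
Proof. by rewrite /word_eval big_seq1. Qed.

Lemma word_evalM : {morph word_eval g : u v / u * v}.
Proof.
rewrite /word_eval => -[s red_s] [t red_t] /=; elim: s {red_s} => [|a s IHs] /=.
  by rewrite big_nil mul1g.
rewrite big_cons -mulgA -IHs; case: (cat_reduce s t) => [|b r] /=.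
  by rewrite big_seq1 big_nil mulg1.
case: eqP => [->|_]; rewrite !big_cons //= mulgA.
by case: (a.2); rewrite ?mulgV ?mulVg mul1g.
Qed.

End WordEval.

End FreeGroup.

(** Subgroup generated by [S], and commutator subgroup, in a possibly infinite
    group. *)
Inductive generated (G : groupType) (S : G -> Prop) : G -> Prop :=
| generated_in x : S x -> generated S x
| generated_1 : generated S 1
| generated_M x y : generated S x -> generated S y -> generated S (x * y)
| generated_V x : generated S x -> generated S x^-1.

Definition commutator_subgroup (G : groupType) : G -> Prop :=
  generated (fun z : G => exists x y : G, z = [~ x, y]).

Definition commutator_word (n : nat) (w : free_group n) : Prop :=
  commutator_subgroup w.

Section Breadth.

Variables (n : nat) (w : free_group n) (gT : finGroupType).

Definition word_values (A : {set gT}) : {set gT} :=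
  [set word_eval g w | g : {ffun 'I_n -> gT} in ffun_on A].

Definition verbal_subgroup (A : {set gT}) : {set gT} :=
  <<word_values A :|: [set x^-1 | x in word_values A]>>.

Canonical verbal_subgroup_group (A : {set gT}) : {group gT} :=
  Eval hnf in [group of verbal_subgroup A].

(** For finite [G] the supremum is a maximum over finitely many subgroups. *)
Definition breadth (G : {set gT}) : nat :=
  \max_(H : {group gT} | H \subset G) #|H : verbal_subgroup H|.

End Breadth.

(** The groups satisfying [P] fall into finitely many isomorphism classes. *)
Definition finitely_many_up_to_isog (P : finGroupType -> Prop) : Prop :=
  exists L : seq finGroupType, forall gT : finGroupType, P gT ->
    exists2 hT : finGroupType, List.In hT L & [set: gT] \isog [set: hT].

(* Main.v *)
Require Import Defs.
From mathcomp Require Import all_boot all_fingroup.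
From mathcomp Require Import zmodp cyclic pgroup sylow maximal.

Set Implicit Arguments.
Unset Strict Implicit.
Unset Printing Implicit Defensive.

(** Why the theorem holds.

    The word [w] fails to be a commutator word exactly when some generator
    x_i has nonzero exponent sum in [w], that is, when the letters (x_i)^+1 and
    (x_i)^-1 do not occur equally often ([balanced_prod_commutator]).

    If this happens, let [p] be a prime larger than both numbers of occurrences.
    Specialising x_i to a generator of a group of order [p] and the other
    variables to 1 gives a nontrivial value of [w]; so w(H) = H for both
    subgroups H, and the breadth is 1 ([unbalanced_breadth_prime]). Thus
    infinitely many groups have breadth at most 1.

    If [w] is a commutator word, then w(A) = 1 for every abelian subgroup A, so
    that breadth at most [m] bounds the order of A by [m]
    ([abelian_leq_breadth]). A finite group whose abelian subgroups have order
    at most [m] has bounded order: a maximal normal abelian subgroup A of a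
    Sylow subgroup P is its own centraliser in P, hence P / A embeds in the
    permutations of A and |P| divides |A| |A|!, which divides (m!)^2. All
    Sylow orders of G dividing (m!)^2, so does |G| ([card_dvd_of_abelian_leq]).
    By Cayley's theorem there are only finitely many groups of bounded order
    ([finitely_many_bounded_card]). *)

(** * Words with vanishing exponent sums *)

Section BalancedWords.

Local Open Scope group_scope.

Variable n : nat.

Definition letter_value (G : groupType) (g : 'I_n -> G) (a : letter n) : G :=
  if a.2 then g a.1 else (g a.1)^-1.

Definition balanced (s : seq (letter n)) : Prop :=
  forall i, count_mem (i, true) s = count_mem (i, false) s.

Lemma letter_valueV (G : groupType) (g : 'I_n -> G) a :
  letter_value g (letter_inv a) = (letter_value g a)^-1.
Proof. by case: a => i [] //=; rewrite /letter_value /= invgK. Qed.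

(** The first letter [a] of a balanced word has its inverse further on, and
    moving the two letters next to each other changes the product by the
    commutator of the value of [a] and the factor in between. What is left is
    a shorter balanced word, though possibly not a reduced one; hence the
    statement about arbitrary words. *)
Lemma balanced_prod_commutator (G : groupType) (g : 'I_n -> G) s :
  balanced s -> commutator_subgroup (\prod_(a <- s) letter_value g a).
Proof.
have [k] := ubnP (size s); elim: k s => // k IHk [|a s] /= le_s_k bal_s.
  by rewrite big_nil; apply: generated_1.
have: letter_inv a \in s.
  case: a bal_s {le_s_k} => i [] /(_ i) /=; rewrite -has_pred1 has_count.
    by rewrite eqxx -pair_eqE /= andbF add0n => <-.
  by rewrite eqxx -pair_eqE /= andbF add0n => ->.
move=> a'_s; case/splitPr: a'_s le_s_k bal_s => s1 s2 le_s_k bal_s.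
have bal12: balanced (s1 ++ s2).
  move=> i; have := bal_s i; rewrite /= !count_cat /=.
  case: a {le_s_k bal_s} => j b; rewrite /letter_inv /= -!pair_eqE /=.
  case: (j == i) => //=; case: b => //=; rewrite !add1n !add0n ?addnS;
    by case.
rewrite big_cons big_cat big_cons letter_valueV.
set x := letter_value g a; set y := \prod_(b <- s1) _.
have ->: forall z, x * (y * (x^-1 * z)) = [~ x^-1, y^-1] * (y * z).
  by move=> z; rewrite commgEl conjgE !invgK !mulgA mulgKV.
rewrite -big_cat; apply: generated_M.
  by apply: generated_in; exists x^-1, y^-1.
apply: IHk bal12; move: le_s_k.
by rewrite !size_cat /= addnS !ltnS => /ltnW.
Qed.

(** A reduced word is the product of its letters, which brings the statement on
    balanced products back to the free group. *)
Lemma word_eval_fg_gen (w : free_group n) : word_eval (@fg_gen n) w = w.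
Proof.
case: w => s red_s; rewrite /word_eval /=.
elim: s red_s => [|a s IHs] red_s.
  by rewrite big_nil; apply: val_inj.
rewrite big_cons (IHs (reduced_behead red_s)); apply: val_inj.
by case: a red_s => i [] red_s; apply: push_cons.
Qed.

Lemma balanced_commutator_word (w : free_group n) :
  balanced w -> commutator_word w.
Proof.
move/(balanced_prod_commutator (@fg_gen n)).
by rewrite -/(word_eval _ w) word_eval_fg_gen.
Qed.

(** When every variable except x_i is specialised to 1, the positive and
    negative occurrences of x_i can be collected, because they commute. *)
Lemma prod_single_generator (G : groupType) (x : G) i s :
  \prod_(a <- s) letter_value (fun j => if j == i then x else 1) a
    = x ^+ count_mem (i, true) s * x^-1 ^+ count_mem (i, false) s.
Proof.
elim: s => [|[j b] s IHs] /=; first by rewrite big_nil mulg1.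
rewrite big_cons {}IHs /letter_value /= -!pair_eqE /=.
case: (j == i); case: b; rewrite ?invg1 ?mul1g //= ?add1n ?add0n !expgS ?mulgA //.
have cxV: commute x^-1 (x ^+ count_mem (i, true) s).
  by apply: commuteX; apply: commute_sym; apply: commuteV.
by rewrite cxV.
Qed.

End BalancedWords.

Section UnbalancedWords.

Local Open Scope group_scope.

Variables (n : nat) (w : free_group n) (i : 'I_n) (gT : finGroupType).

(** A word value different from 1 generates the whole group, which has no proper
    nontrivial subgroups. Here the value is the power of [x] whose exponent is
    the exponent sum of x_i; it is not 1 because the order of [x] exceeds both
    numbers of occurrences. *)
Lemma unbalanced_breadth_prime :
  count_mem (i, true) w != count_mem (i, false) w ->
  count_mem (i, true) w < #|gT| -> count_mem (i, false) w < #|gT| ->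
  prime #|gT| -> breadth w [set: gT] <= 1.
Proof.
move=> neq_w lt1 lt2 pr_gT; apply/bigmax_leqP=> H _.
rewrite (_ : #|H : _| = 1%N) //; apply/eqP; rewrite indexg_eq1.
have [->|] := eqVneq H 1%G; first exact: sub1G.
case/trivgPn=> x Hx ntx.
pose g := [ffun j : 'I_n => if j == i then x else 1].
have gH: g \in ffun_on H.
  by apply/ffun_onP => j; rewrite ffunE; case: ifP.
set v := word_eval g w.
have vw: v \in verbal_subgroup w H.
  by apply/mem_gen/setUP; left; apply: imset_f.
have ox: #[x] = #|gT|.
  have : #[x] %| #|gT| by rewrite -cardsT order_dvdG ?inE.
  by case/primeP: pr_gT => _ /[apply] /predU1P[/eqP|/eqP //]; rewrite order_eq1 (negPf ntx).
have ntv: v != 1.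
  apply: contra neq_w => /eqP v1.
  have := prod_single_generator x i w.
  rewrite (eq_bigr (fun a => letter_value g a)) => [|a _]; last first.
    by rewrite /letter_value ffunE.
  rewrite -/(word_eval g w) -/v v1 expVgn => /esym/eqP; rewrite -eq_mulgV1.
  by rewrite eq_expg_mod_order ox !modn_small.
have pr_v: prime #|[set: gT]| by rewrite cardsT.
apply: subset_trans (subsetT H) _.
apply: contraR ntv => /(prime_TIg pr_v) tiG.
by rewrite -in_set1 -[[set 1]]tiG !inE.
Qed.
End UnbalancedWords.

(** * Commutator words *)

Section CommutatorWords.

Local Open Scope group_scope.

Variables (n : nat) (gT : finGroupType).

Lemma word_eval1 (G : groupType) (g : 'I_n -> G) : word_eval g 1 = 1.
Proof. by rewrite /word_eval big_nil. Qed.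

Lemma word_evalV (G : groupType) (g : 'I_n -> G) (u : free_group n) :
  word_eval g u^-1 = (word_eval g u)^-1.
Proof. by apply: (mulgI (word_eval g u)); rewrite -word_evalM !mulgV word_eval1. Qed.

Lemma word_eval_in (A : {group gT}) (g : 'I_n -> gT) (u : free_group n) :
  (forall i, g i \in A) -> word_eval g u \in A.
Proof.
by move=> gA; apply: group_prod => a _; case: ifP; rewrite ?groupV gA.
Qed.

Lemma commutator_word_eval_abelian (w : free_group n) (A : {group gT})
    (g : 'I_n -> gT) :
  commutator_word w -> abelian A -> (forall i, g i \in A) -> word_eval g w = 1.
Proof.
move=> cw abA gA; elim: cw => [_ [x [y ->]]||x y _ Ex _ Ey|x _ Ex].
- have: word_eval g x * word_eval g y = word_eval g y * word_eval g x.
    by apply: (centsP abA); apply: word_eval_in.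
  rewrite commgEl conjgE !word_evalM !word_evalV => ->.
  by rewrite mulKg mulVg.
- exact: word_eval1.
- by rewrite word_evalM Ex Ey mulg1.
- by rewrite word_evalV Ex invg1.
Qed.

Lemma verbal_subgroup_abelian (w : free_group n) (A : {group gT}) :
  commutator_word w -> abelian A -> verbal_subgroup w A = 1.
Proof.
move=> cw abA; apply/trivgP; rewrite gen_subG.
have E: word_values w A \subset [1 gT].
  apply/subsetP=> _ /imsetP[g /ffun_onP gA ->].
  by rewrite (commutator_word_eval_abelian cw abA) ?set11.
rewrite subUset E; apply/subsetP=> _ /imsetP[x /(subsetP E)/set1P-> ->].
by rewrite invg1 set11.
Qed.

Lemma abelian_leq_breadth (w : free_group n) (G A : {group gT}) :
  commutator_word w -> A \subset G -> abelian A -> #|A| <= breadth w G.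
Proof.
move=> cw sAG abA; rewrite -(indexg1 A) -(verbal_subgroup_abelian cw abA).
exact: (@leq_bigmax_cond _ _ (fun H : {group gT} => #|H : verbal_subgroup w H|)).
Qed.

End CommutatorWords.

(** * Groups with small abelian subgroups *)

Section SmallAbelianSubgroups.

Local Open Scope group_scope.

Variables (gT : finGroupType) (m : nat).

(** The conjugation action of P on A has kernel 'C_P(A) = A, so P / A is a group
    of permutations of A and the index of A in P divides |A|!. *)
Lemma card_dvd_self_centralising (P A : {group gT}) :
  A <| P -> 'C_P(A) = A -> #|P| %| #|A| * #|A|`!.
Proof.
case/andP=> sAP nAP defA; rewrite -(Lagrange sAP) dvdn_mul //.
have <-: #|conj_aut A @* P| = #|P : A|.
  by rewrite card_morphim ker_conj_aut (setIidPr nAP) -{2}defA indexgI.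
rewrite -card_Sym; apply: cardSg; apply: subset_trans (Aut_conj_aut A P) _.
by apply/subsetP=> f; rewrite !inE => /andP[].
Qed.

(** A bound by divisibility rather than size controls all primes at once: it is
    enough that every Sylow subgroup has order dividing the same number. *)
Lemma card_dvd_of_abelian_leq (G : {group gT}) :
  (forall A : {group gT}, A \subset G -> abelian A -> #|A| <= m) ->
  #|G| %| m`! * m`!.
Proof.
move=> leAm; apply/dvdn_partP => // p _.
have [P sylP] := Sylow_exists p G; rewrite -(card_Hall sylP).
have [A maxA] : {A : {group gT} | [max A | A <| P & abelian A]}.
  by apply: ex_maxgroup; exists 1%G; rewrite normal1 abelian1.
have SCN_A := max_SCN (pHall_pgroup sylP) maxA.
have [nAP defA] := SCN_P SCN_A.
have leA: #|A| <= m.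
  apply: leAm (SCN_abelian SCN_A).
  exact: subset_trans (normal_sub nAP) (pHall_sub sylP).
apply: dvdn_trans (card_dvd_self_centralising nAP defA) _.
by apply: dvdn_mul; [apply: dvdn_fact; rewrite cardG_gt0 | rewrite (fact_split leA) dvdn_mulr].
Qed.

End SmallAbelianSubgroups.

(** * Finitely many groups of bounded order *)

Section BoundedOrder.

Local Open Scope group_scope.

Lemma mem_In (T : eqType) (x : T) (s : seq T) : x \in s -> List.In x s.
Proof. by elim: s => //= y s IHs /[1!inE] /predU1P[->|/IHs]; [left|right]. Qed.

(** Cayley's embedding, transported to a symmetric group that depends on the
    order of the group only, so that bounded order leaves finitely many
    targets. *)
Lemma isog_subgroup_perm_ord (gT : finGroupType) :
  exists H : {group {perm 'I_#|gT|}}, [set: gT] \isog H.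
Proof.
pose to (k : 'I_#|gT|) (x : gT) := enum_rank (enum_val k * x).
have to1 k : to k 1 = k by rewrite /to mulg1 enum_valK.
have toM k x y : to k (x * y) = to (to k x) y by rewrite /to enum_rankK mulgA.
pose act := TotalAction to1 toM.
exists (actperm act @* [set: gT])%G; apply: sub_isog (subsetT _) _.
apply/injmP=> x y _ _ /permP/(_ (enum_rank 1)).
by rewrite !actpermE /= /to enum_rankK !mul1g => /enum_rank_inj.
Qed.

Lemma finitely_many_bounded_card (N : nat) (P : finGroupType -> Prop) :
  (forall gT : finGroupType, P gT -> #|gT| <= N) -> finitely_many_up_to_isog P.
Proof.
move=> leN.
pose Lk k := [seq (subg_of H : finGroupType)
             | H : {group {perm 'I_k}} <- enum {group {perm 'I_k}}].
exists (List.flat_map Lk (iota 0 N.+1)) => gT /leN le_gT_N.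
have [H isoH] := isog_subgroup_perm_ord gT.
exists (subg_of H); last exact: isog_trans isoH (isog_subg H).
apply/List.in_flat_map; exists #|gT|; split.
  by apply: mem_In; rewrite mem_iota.
apply: (List.in_map
  (fun H : {group {perm 'I_#|gT|}} => (subg_of H : finGroupType))).
by apply: mem_In; rewrite mem_enum.
Qed.

End BoundedOrder.

Theorem theorem2p2 (n : nat) (hn : (0 < n)%N) (w : free_group n) :
  commutator_word w <->
  (forall m : nat, (0 < m)%N ->
     finitely_many_up_to_isog
       (fun gT : finGroupType => (breadth w [set: gT] <= m)%N)).
Proof.
split=> [cw m _ | /(_ 1 isT)[L LP]].
  apply: (@finitely_many_bounded_card (m`! * m`!)) => gT le_br_m.
  rewrite -cardsT dvdn_leq ?muln_gt0 ?fact_gt0 //.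
  apply: (@card_dvd_of_abelian_leq _ _ [group of [set: gT]]) => A sAG abA.
  exact: leq_trans (abelian_leq_breadth cw sAG abA) le_br_m.
apply: balanced_commutator_word => i; apply/eqP/negPn/negP => neq_w.
(* The group of order p has breadth 1 since p > c, but it is too large to be
   isomorphic to a member of L. *)
pose c := count_mem (i, true) w + count_mem (i, false) w.
pose N := c + sumn [seq #|(hT : finGroupType)| | hT <- L].
have [[//|p] ltNp pr_p] := prime_above N.
have [|hT hTL iso_hT] := LP 'I_p.+1.
  have ltcp : c < p.+1 by apply: leq_ltn_trans ltNp; apply: leq_addr.
  apply: (@unbalanced_breadth_prime _ _ i); rewrite ?card_ord //.
    exact: leq_ltn_trans (leq_addr _ _) ltcp.
  exact: leq_ltn_trans (leq_addl _ _) ltcp.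
have: p.+1 <= N.
  rewrite -(card_ord p.+1) -cardsT (card_isog iso_hT) cardsT.
  apply: leq_trans (leq_addl _ _).
  elim: L hTL {LP N ltNp} => //= kT L IHL [->|/IHL le]; first exact: leq_addr.
  exact: leq_trans le (leq_addl _ _).
by rewrite leqNgt ltNp.
Qed.
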